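(* Let $n\ge2$, $d\in\mathbb R$, $\delta\ge0$, and let $C:\mathbb R^n_{+,0}\setminus\{0\}\to\mathbb R_+$ be continuously differentiable and homogeneous of degree $d$. Suppose that $$\frac{\partial C}{\partial\xi_j}(\xi)-(d-1)C(\xi)>\delta\qquad\text{for all }\xi\in\Xi_n\text{ and all } j\in I(\xi).$$ Then the mode with cost $C$ is absolutely $\delta$-causal.
   Context: $\Xi_n=\{\xi\in\mathbb R^n:\xi_1+\dots+\xi_n=1,\ \xi_j\ge0\ \forall j\}$; $I(\xi)=\{i:\xi_i>0\}$; $\mathbb R_+=(0,\infty)$; $\mathbb R^n_{+,0}=\{W\in\mathbb R^n:W_j\ge0\ \forall j\}$. Homogeneous of degree $d$ means $C(a\xi)=a^dC(\xi)$ for all $a>0$ and all $\xi$ in the domain. Continuously differentiable on $\mathbb R^n_{+,0}\setminus\{0\}$ means that $C$ is the restriction of a $C^1$ function defined on an open neighborhood of this set. A mode with $n$ successor nodes is described by its transition-cost function $C$ restricted to $\Xi_n$. For $W\in\mathbb R^n_{+,0}$, $V(W)=\min_{\xi\in\Xi_n}\{C(\xi)+\xi^TW\}$ and $\Xi^*(W)$ is the set of minimizers. The mode is absolutely $\delta$-causal if for all $W\in\mathbb R^n_{+,0}$, all $\xi^*\in\Xi^*(W)$ and all $j\in\{1,\dots,n\}$: $\xi^*_j>0$ implies $V(W)>W_j+\delta$. *)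

(* Defs.v *)
From HB Require Import structures.
From mathcomp Require Import all_boot all_order all_algebra.
From mathcomp Require Import all_classical all_reals all_analysis.

Set Implicit Arguments.
Unset Strict Implicit.
Unset Printing Implicit Defensive.

Import Order.TTheory GRing.Theory Num.Theory.
Import numFieldNormedType.Exports.

Local Open Scope classical_set_scope.
Local Open Scope ring_scope.

(* A function with domain D, a subset of R^n, is represented by a total
   function on 'rV[R]_n; every definition below depends only on its values
   on D. *)

Definition nonneg_orthant (R : realType) (n : nat) : set 'rV[R]_n :=
  [set x | forall j, 0 <= x 0 j].

Definition punctured_orthant (R : realType) (n : nat) : set 'rV[R]_n :=
  @nonneg_orthant R n `\ 0.

Definition simplex (R : realType) (n : nat) : set 'rV[R]_n :=
  [set x | \sum_(j < n) x 0 j = 1 /\ forall j, 0 <= x 0 j].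

Definition homogeneous_on (R : realType) (n : nat) (D : set 'rV[R]_n)
    (d : R) (C : 'rV[R]_n -> R) : Prop :=
  forall (a : R) (x : 'rV[R]_n), 0 < a -> D x -> C (a *: x) = a `^ d * C x.

(* In finite dimension, continuity of x |-> 'd F x is the continuity of
   x |-> 'D_v F x = 'd F x v for every direction v. *)
Definition C1_on_open (R : realType) (n : nat) (U : set 'rV[R]_n)
    (F : 'rV[R]_n -> R) : Prop :=
  forall x, U x ->
    differentiable F x /\
    forall v : 'rV[R]_n, {for x, continuous (fun y => 'D_v F y)}.

Definition C1_on (R : realType) (n : nat) (D : set 'rV[R]_n)
    (C : 'rV[R]_n -> R) : Prop :=
  exists (U : set 'rV[R]_n) (F : 'rV[R]_n -> R),
    [/\ open U, D `<=` U, C1_on_open U F & {in D, C =1 F}].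

(* If x is in the punctured orthant and 0 < x 0 j, then x + h e_j stays in
   the punctured orthant for small h of either sign, so this two-sided
   derivative depends only on the values of C there. *)
Definition partial_deriv (R : realType) (n : nat) (C : 'rV[R]_n -> R)
    (j : 'I_n) (x : 'rV[R]_n) : R :=
  'D_(delta_mx 0 j) C x.

Definition mode_objective (R : realType) (n : nat) (C : 'rV[R]_n -> R)
    (W x : 'rV[R]_n) : R :=
  C x + \sum_(j < n) x 0 j * W 0 j.

(* The infimum is the minimum whenever [mode_minimizers C W] is nonempty, in
   particular when C is continuous on the simplex and n > 0. *)
Definition mode_value (R : realType) (n : nat) (C : 'rV[R]_n -> R)
    (W : 'rV[R]_n) : R :=
  inf [set mode_objective C W x | x in @simplex R n].

Definition mode_minimizers (R : realType) (n : nat) (C : 'rV[R]_n -> R)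
    (W : 'rV[R]_n) : set 'rV[R]_n :=
  [set x | simplex x /\
    forall y, simplex y -> mode_objective C W x <= mode_objective C W y].

Definition absolutely_causal (R : realType) (n : nat) (delta : R)
    (C : 'rV[R]_n -> R) : Prop :=
  forall W, nonneg_orthant W -> forall x, mode_minimizers C W x ->
    forall j : 'I_n, 0 < x 0 j -> mode_value C W > W 0 j + delta.

(* Main.v *)
(** Let x minimize the objective for W, with x_j > 0.  For small t of either
    sign, (x + t e_j) / (1 + t) is feasible; by homogeneity, multiplying its
    objective by 1 + t turns minimality into
      (1 + t)^(1 - d) C(x + t e_j) + W.x + t W_j - (1 + t) V(W) >= 0,
    with equality at t = 0.  Differentiating at t = 0 gives
    V(W) = d_j C(x) - (d - 1) C(x) + W_j, which exceeds W_j + delta.  Scaling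
    back to the simplex takes the place of Euler's identity, so no tangential
    derivative of C is needed. *)

Require Import Defs.
From mathcomp Require Import all_boot all_order all_algebra.
From mathcomp Require Import all_classical all_reals all_analysis.
From mathcomp Require Import ring lra.
Import Order.TTheory GRing.Theory Num.Theory.
Import numFieldNormedType.Exports.
Local Open Scope classical_set_scope.
Local Open Scope ring_scope.

Lemma mode_value_minimizer (R : realType) (n : nat) (C : 'rV[R]_n -> R)
    (W x : 'rV[R]_n) :
  mode_minimizers C W x -> mode_value C W = mode_objective C W x.
Proof.
move=> [sx minx]; apply/eqP; rewrite eq_le; apply/andP; split.
  apply: ge_inf; last by exists x.
  by exists (mode_objective C W x) => _ [y sy <-]; exact: minx.
apply: lb_le_inf; first by exists (mode_objective C W x); exists x.
by move=> _ [y sy <-]; exact: minx.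
Qed.

Lemma line_coord (R : realType) (n : nat) (x : 'rV[R]_n) (j i : 'I_n) (t : R) :
  (x + t *: delta_mx 0 j) 0 i = x 0 i + t * (i == j)%:R.
Proof. by rewrite !mxE eqxx. Qed.

(** Only coordinate [j] moves, and its new value is positive, which also excludes the zero
    vector. *)
Lemma punctured_orthant_line (R : realType) (n : nat) (x : 'rV[R]_n) (j : 'I_n)
    (t : R) :
  nonneg_orthant x -> 0 < x 0 j + t ->
  punctured_orthant (x + t *: delta_mx 0 j).
Proof.
move=> x0 xjt; split.
  move=> i; rewrite line_coord.
  by have [->|_] := eqVneq i j; rewrite ?mulr1 ?mulr0 ?addr0 ?(ltW xjt).
by move=> /= /rowP/(_ j); rewrite line_coord eqxx mulr1 mxE => E; lra.
Qed.

Lemma line_sum (R : realType) (n : nat) (x w : 'rV[R]_n) (j : 'I_n) (t : R) :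
  \sum_i (x + t *: delta_mx 0 j) 0 i * w 0 i = \sum_i x 0 i * w 0 i + t * w 0 j.
Proof.
under eq_bigr => i _ do rewrite line_coord mulrDl.
rewrite big_split/= [X in _ + X](bigD1 j)//= eqxx mulr1 [X in _ + (_ + X)]big1 ?addr0//.
by move=> i /negbTE ->; rewrite mulr0 mul0r.
Qed.

(** The condition on [t] is open, so for [s] near [t] the line stays in the punctured orthant. There
    [C] agrees with its differentiable extension [F], and [F] composed with an affine map is
    derivable. *)
Lemma derivable_line (R : realType) (n : nat) (C : 'rV[R]_n -> R)
    (x : 'rV[R]_n) (j : 'I_n) (t : R) :
  C1_on (@punctured_orthant R n) C -> nonneg_orthant x -> 0 < x 0 j + t ->
  derivable (fun s : R => C (x + s *: delta_mx 0 j)) t 1.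
Proof.
move=> [U [F [_ subU FC1 CF]]] x0 xjt.
apply: (@near_eq_derivable _ _ _ (fun s : R => F (x + s *: delta_mx 0 j))).
  near=> s; apply/esym/CF/mem_set/punctured_orthant_line => //.
  rewrite addrC -ltrBlDr sub0r; near: s; apply: lt_nbhsr.
  by rewrite -subr_gt0 opprK addrC.
have [dF _] := FC1 _ (subU _ (punctured_orthant_line _ _ _ _ _ x0 xjt)).
apply/derivable1_diffP.
apply: (@differentiable_comp _ _ _ _ (fun s : R => x + s *: delta_mx 0 j) F) => //.
Unshelve. all: by end_near. Qed.

(** Both derivatives are limits of the same difference quotient. *)
Lemma derive_line0 (R : realType) (n : nat) (C : 'rV[R]_n -> R)
    (x v : 'rV[R]_n) :
  'D_1 (fun s : R => C (x + s *: v)) 0 = 'D_v C x.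
Proof.
rewrite /derive; set q := (X in lim (X @ _)); set r := (X in _ = lim (X @ _)).
suff -> : q = r by [].
apply/funext => h; rewrite /q /r /=.
by rewrite scale0r !addr0 [h *: 1]mulr1 (addrC x).
Qed.

Lemma minimizer_line_ge0 (R : realType) (n : nat) (d : R) (C : 'rV[R]_n -> R)
    (W x : 'rV[R]_n) (j : 'I_n) (t : R) :
  homogeneous_on (@punctured_orthant R n) d C -> mode_minimizers C W x ->
  0 < x 0 j + t -> 0 < 1 + t ->
  0 <= (1 + t) `^ (1 - d) * C (x + t *: delta_mx 0 j)
    + (\sum_i x 0 i * W 0 i + t * W 0 j - (1 + t) * mode_objective C W x).
Proof.
move=> hom [[sx1 sx0] minx] xjt t1.
have [yge0 yn0] := punctured_orthant_line _ _ _ _ _ sx0 xjt.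
have syy : simplex ((1 + t)^-1 *: (x + t *: delta_mx 0 j)).
  split.
    under eq_bigr => i _ do rewrite mxE.
    rewrite -mulr_sumr.
    (* With all weights equal to 1, [line_sum] gives the coordinate sum [1 + t], which the scaling
       factor cancels. *)
    have := line_sum _ _ x (const_mx 1) j t.
    under eq_bigr => i _ do rewrite [const_mx _ _ _]mxE mulr1.
    under [in X in _ = X -> _]eq_bigr => i _ do rewrite mxE mulr1.
    by rewrite mxE mulr1 sx1 => ->; rewrite mulVf// gt_eqF.
  by move=> i; rewrite mxE mulr_ge0// invr_ge0 ltW.
have := minx _ syy; rewrite [X in _ <= X -> _]/mode_objective hom//; last by rewrite invr_gt0.
under eq_bigr => i _ do rewrite mxE -mulrA.
rewrite -mulr_sumr line_sum -(ler_pM2l t1); set m := mode_objective C W x.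
rewrite [X in _ <= X -> _]mulrDr !mulrA.
rewrite mulfV ?gt_eqF// mul1r.
(* One factor [1 + t] comes from clearing the denominator, the other power from homogeneity with
   scale [(1 + t)^-1]. *)
have -> : (1 + t) * (1 + t)^-1 `^ d = (1 + t) `^ (1 - d).
  rewrite powRD; last by rewrite (gt_eqF t1) implybT.
  by rewrite powRr1 ?(ltW t1)// -[_^-1]powR_inv1 ?(ltW t1)// -powRrM mulN1r.
by rewrite [X in _ -> 0 <= X]addrA subr_ge0.
Qed.

Lemma minimizer_stationary (R : realType) (n : nat) (d : R)
    (C : 'rV[R]_n -> R) (W x : 'rV[R]_n) (j : 'I_n) :
  C1_on (@punctured_orthant R n) C ->
  homogeneous_on (@punctured_orthant R n) d C -> mode_minimizers C W x ->
  0 < x 0 j ->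
  mode_objective C W x = partial_deriv C j x - (d - 1) * C x + W 0 j.
Proof.
move=> C1 hom minx xj; have [[sx1 sx0] _] := minx.
(* This bound makes [1 + t] positive as soon as [t > - x 0 j]. *)
have xj1 : x 0 j <= 1.
  by rewrite -sx1 (bigD1 j)//= lerDl sumr_ge0// => i _; exact: sx0.
(* [p * g + q] is the expression of [minimizer_line_ge0] as a function of the step along the
   line. *)
set m := mode_objective C W x.
pose g (s : R) := C (x + s *: delta_mx 0 j).
pose p (s : R) := (1 + s) `^ (1 - d).
pose q (s : R) := \sum_i x 0 i * W 0 i + s * W 0 j - (1 + s) * m.
have dq (t : R) : is_derive t 1 q (W 0 j - m).
  have -> : q = cst (\sum_i x 0 i * W 0 i) + (W 0 j \*: id) - (m \*: (cst 1 + id)).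
    apply/funext => s; rewrite /q /= !fctE /=.
    by rewrite /GRing.scale /= [W 0 j * _]mulrC [m * _]mulrC.
  by apply: is_derive_eq; rewrite !add0r /GRing.scale/= !mulr1.
have dp (t : R) : 0 < 1 + t -> is_derive t 1 p ((1 - d) * (1 + t) `^ (1 - d - 1)).
  move=> t1; have dp0 := @is_derive1_powR R (1 - d) _ t1.
  have ds : is_derive t 1 (fun s : R => 1 + s) 1.
    have -> : (fun s : R => 1 + s) = cst 1 + id by [].
    by apply: is_derive_eq; rewrite add0r.
  have := @is_derive1_comp R (@powR R ^~ (1 - d)) (fun s : R => 1 + s) t _ _ dp0 ds.
  by rewrite mulr1.
have dpg (t : R) : 0 < x 0 j + t -> 0 < 1 + t ->
    is_derive t 1 (p * g + q)
      ((p t *: 'D_1 g t + g t *: ((1 - d) * (1 + t) `^ (1 - d - 1))) + (W 0 j - m)).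
  move=> xjt t1; apply: is_deriveD; apply: is_deriveM; first exact: dp.
  by apply/derivableP/derivable_line.
have xjoo (t : R) : t \in `](- x 0 j), (x 0 j)[ -> 0 < x 0 j + t /\ 0 < 1 + t.
  by rewrite in_itv /= => /andP[? ?]; split; lra.
have f0 : (p * g + q) 0 = 0.
  rewrite !fctE /p /q /g addr0 powR1 scale0r addr0 !mul1r mul0r addr0.
  by rewrite /m /mode_objective; ring.
(* Fermat's rule: [p * g + q] is nonnegative on an open interval around 0 and vanishes at 0. *)
have D0 : is_derive (0 : R) 1 (p * g + q) 0.
  apply: (@derive1_at_min R _ (- x 0 j) (x 0 j)).
  - by lra.
  - by move=> t /xjoo[xjt t1]; have /@ex_derive := dpg _ xjt t1.
  - by rewrite in_itv /= oppr_lt0 xj.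
  - by move=> t /xjoo[xjt t1]; rewrite f0; exact: minimizer_line_ge0.
have xj0 : 0 < x 0 j + 0 by rewrite addr0.
have t10 : 0 < 1 + 0 :> R by rewrite addr0.
(* Equating the two values of the derivative at 0 gives [partial_deriv C j x + (1 - d) * C x + W 0 j
   - m = 0]. *)
have := @derive_val _ _ _ _ _ _ _ (dpg 0 xj0 t10).
rewrite (@derive_val _ _ _ _ _ _ _ D0) /g derive_line0 /p scale0r !addr0 !powR1.
rewrite scale1r mulr1 /GRing.scale /= /partial_deriv => E; lra.
Qed.

Theorem theorem3p2 (R : realType) (n : nat) (d delta : R)
    (C : 'rV[R]_n -> R)
    (hn : (2 <= n)%N)
    (hdelta : 0 <= delta)
    (hpos : forall x : 'rV[R]_n, punctured_orthant x -> 0 < C x)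
    (hC1 : C1_on (@punctured_orthant R n) C)
    (hhom : homogeneous_on (@punctured_orthant R n) d C)
    (hderiv : forall x : 'rV[R]_n, simplex x -> forall j : 'I_n, 0 < x 0 j ->
       partial_deriv C j x - (d - 1) * C x > delta) :
  absolutely_causal delta C.
Proof.
move=> W _ x minx j xj.
rewrite (mode_value_minimizer _ _ _ _ _ minx).
rewrite (minimizer_stationary _ _ _ _ _ _ _ hC1 hhom minx xj).
by rewrite [W 0 j + _]addrC ltrD2r; apply: hderiv => //; case: minx.
Qed.
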